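(* Let $\mathfrak{g}$ be a $(2n+1)$-dimensional nilpotent real Lie algebra admitting a Sasakian structure. Then $\mathfrak{g}$ is isomorphic to the $(2n+1)$-dimensional real Heisenberg Lie algebra $\mathfrak{h}_{2n+1}$.
   Context: For a $1$-form $\alpha\in\mathfrak{g}^*$, $\mathrm{d}\alpha(X,Y)=-\alpha([X,Y])$. A Sasakian structure on a $(2n+1)$-dimensional Lie algebra $\mathfrak{g}$ is a quadruple $(\Phi,\alpha,\xi,g)$ with $\Phi\in\mathrm{End}(\mathfrak{g})$, $\alpha\in\mathfrak{g}^*$, $\xi\in\mathfrak{g}$ and $g$ an inner product on $\mathfrak{g}$ such that for all $X,Y\in\mathfrak{g}$: $\alpha(\xi)=1$; $\Phi^2=-\mathrm{I}+\xi\otimes\alpha$; $g(\Phi X,\Phi Y)=g(X,Y)-\alpha(X)\alpha(Y)$; $2g(X,\Phi Y)=\mathrm{d}\alpha(X,Y)$; and $N_\Phi=-\mathrm{d}\alpha\otimes\xi$, where $N_\Phi(X,Y)=\Phi^2[X,Y]+[\Phi X,\Phi Y]-\Phi[\Phi X,Y]-\Phi[X,\Phi Y]$. $\mathfrak{h}_{2n+1}$ is the Lie algebra with basis $X_1,\dots,X_n,Y_1,\dots,Y_n,Z$ and only nonzero brackets $[X_i,Y_i]=Z$, $i=1,\dots,n$ (up to skew-symmetry). *)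

(* Defs.v *)
From HB Require Import structures.
From mathcomp Require Import all_boot all_order all_algebra.
From mathcomp Require Import reals.

Set Implicit Arguments.
Unset Strict Implicit.
Unset Printing Implicit Defensive.

Import Order.TTheory GRing.Theory Num.Theory.
Local Open Scope ring_scope.

HB.mixin Record isLieAlgebra (R : fieldType) (L : Type) of Vector R L := {
  lie : L -> L -> L;
  lie_linearl : forall y, linear (lie ^~ y);
  lie_linearr : forall x, linear (lie x);
  liexx : forall x, lie x x = 0;
  lie_jacobi : forall x y z,
    lie x (lie y z) + lie y (lie z x) + lie z (lie x y) = 0
}.

#[short(type="lieAlgType")]
HB.structure Definition LieAlgebra (R : fieldType) :=
  { L of Vector R L & isLieAlgebra R L }.

Notation "[Lie x , y ]" := (lie x y)
  (at level 0, x at level 99, y at level 99, format "[Lie  x ,  y ]")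
  : ring_scope.

Lemma lie_bilinear (R : fieldType) (L : lieAlgType R) :
  bilinear_for *:%R *:%R (@lie R L).
Proof. by split; [exact: lie_linearl|exact: lie_linearr]. Qed.

HB.instance Definition _ (R : fieldType) (L : lieAlgType R) :=
  @bilinear_isBilinear.Build R L L L *:%R *:%R (@lie R L) (@lie_bilinear R L).

(* [U, V], the linear span of the brackets of elements of U and V; see
   memv_lie and liev_sub *)
Definition liev (R : fieldType) (L : lieAlgType R) (U V : {vspace L}) :
    {vspace L} :=
  <<[seq [Lie x, y] | x <- vbasis U, y <- vbasis V]>>%VS.

Lemma memv_lie (R : fieldType) (L : lieAlgType R) (U V : {vspace L}) x y :
  x \in U -> y \in V -> [Lie x, y] \in liev U V.
Proof.
move=> /coord_vbasis-> /coord_vbasis->.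
rewrite linear_sumr memv_suml // => j _.
rewrite linear_sumlz memv_suml // => i _.
rewrite linearZl_LR memvZ // linearZr_LR memvZ // memv_span //.
by apply: allpairs_f; rewrite mem_nth ?size_tuple.
Qed.

Lemma liev_sub (R : fieldType) (L : lieAlgType R) (U V W : {vspace L}) :
  (forall x y, x \in U -> y \in V -> [Lie x, y] \in W) ->
  (liev U V <= W)%VS.
Proof.
move=> UVW; apply/span_subvP => _ /allpairsP[[x y] [/= xU yV ->]].
by apply: UVW; exact: vbasis_mem.
Qed.

Fixpoint lower_central (R : fieldType) (L : lieAlgType R) (k : nat) :
    {vspace L} :=
  if k is k'.+1 then liev fullv (lower_central L k') else fullv.

Definition lie_nilpotent (R : fieldType) (L : lieAlgType R) : Prop :=
  exists k, lower_central L k = 0%VS.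

Definition lie_isomorphic (R : fieldType) (L M : lieAlgType R) : Prop :=
  exists f : 'Hom(L, M),
    bijective f /\ {morph f : x y / [Lie x, y] >-> [Lie x, y]}.

Definition dform (R : fieldType) (L : lieAlgType R) (alpha : 'Hom(L, R^o))
  (X Y : L) : R := - alpha [Lie X, Y].

Definition nijenhuis (R : fieldType) (L : lieAlgType R) (Phi : 'End(L))
  (X Y : L) : L :=
  Phi (Phi [Lie X, Y]) + [Lie Phi X, Phi Y]
  - Phi [Lie Phi X, Y] - Phi [Lie X, Phi Y].

(* {dot L for idfun} is the type of real inner products on L: symmetric
   bilinear positive definite forms *)
Record is_sasakian (R : realFieldType) (L : lieAlgType R) (Phi : 'End(L))
    (alpha : 'Hom(L, R^o)) (xi : L) (g : {dot L for idfun}) : Prop := {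
  sasakian_reeb : alpha xi = 1;
  sasakian_sqr : forall X, Phi (Phi X) = - X + (alpha X : R) *: xi;
  sasakian_metric : forall X Y, g (Phi X) (Phi Y) = g X Y - alpha X * alpha Y;
  sasakian_contact : forall X Y, 2 * g X (Phi Y) = dform alpha X Y;
  sasakian_normal : forall X Y,
    nijenhuis Phi X Y = - (dform alpha X Y *: xi)
}.

(* (p, q, z) stands for
   \sum_i p_i X_i + \sum_i q_i Y_i + z Z; see heisenberg_decomp and the
   brackets heisXY, heisXX, heisYY, heisZ_central *)
Definition heisenberg (R : fieldType) (n : nat) : Type :=
  ('rV[R]_n * 'rV[R]_n * R^o)%type.

HB.instance Definition _ (R : fieldType) (n : nat) :=
  Vector.copy (heisenberg R n) ('rV[R]_n * 'rV[R]_n * R^o)%type.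

Definition heisenberg_lie (R : fieldType) (n : nat) (u v : heisenberg R n) :
    heisenberg R n :=
  (0, 0, \sum_(i < n) (u.1.1 0 i * v.1.2 0 i - u.1.2 0 i * v.1.1 0 i)).

Lemma heisenberg_lie_linearl (R : fieldType) (n : nat) (v : heisenberg R n) :
  linear ((@heisenberg_lie R n) ^~ v).
Proof.
move=> a u u'; rewrite /heisenberg_lie.
congr (_, _, _); rewrite /= ?scaler0 ?addr0 //.
rewrite /GRing.scale /= mulr_sumr -big_split; apply: eq_bigr => i _ /=.
by rewrite !mxE !mulrDl mulrBr !mulrA opprD addrACA.
Qed.

Lemma heisenberg_liexx (R : fieldType) (n : nat) (u : heisenberg R n) :
  heisenberg_lie u u = 0.
Proof.
congr (_, _, _) => /=; apply: big1 => i _.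
by rewrite mulrC subrr.
Qed.

Lemma heisenberg_lie_linearr (R : fieldType) (n : nat) (u : heisenberg R n) :
  linear (heisenberg_lie u).
Proof.
move=> a v v'; rewrite /heisenberg_lie.
congr (_, _, _); rewrite /= ?scaler0 ?addr0 //.
rewrite /GRing.scale /= mulr_sumr -big_split; apply: eq_bigr => i _ /=.
by rewrite !mxE !mulrDr !(mulrCA _ a) mulrN opprD addrACA.
Qed.

Lemma heisenberg_lie_jacobi (R : fieldType) (n : nat)
    (x y z : heisenberg R n) :
  heisenberg_lie x (heisenberg_lie y z) + heisenberg_lie y (heisenberg_lie z x)
  + heisenberg_lie z (heisenberg_lie x y) = 0.
Proof.
have central (u v w : heisenberg R n) :
    heisenberg_lie u (heisenberg_lie v w) = 0.
  congr (_, _, _) => /=; apply: big1 => i _.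
  by rewrite !mxE !mulr0 subrr.
by rewrite !central !addr0.
Qed.

HB.instance Definition _ (R : fieldType) (n : nat) :=
  isLieAlgebra.Build R (heisenberg R n) (@heisenberg_lie_linearl R n)
    (@heisenberg_lie_linearr R n) (@heisenberg_liexx R n)
    (@heisenberg_lie_jacobi R n).

Definition heisX (R : fieldType) (n : nat) (i : 'I_n) : heisenberg R n :=
  (delta_mx 0 i, 0, 0).
Definition heisY (R : fieldType) (n : nat) (i : 'I_n) : heisenberg R n :=
  (0, delta_mx 0 i, 0).
Definition heisZ (R : fieldType) (n : nat) : heisenberg R n := (0, 0, 1).

Lemma dim_heisenberg (R : fieldType) (n : nat) :
  \dim {: heisenberg R n} = n.*2.+1.
Proof.
rewrite dimvf -[LHS]/(1 * n + 1 * n + 1)%N.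
by rewrite !mul1n addnn addn1.
Qed.

Lemma heisenberg_decomp (R : fieldType) (n : nat) (p q : 'rV[R]_n) (z : R) :
  (p, q, z) = \sum_i p 0 i *: heisX R i + \sum_i q 0 i *: heisY R i
              + z *: heisZ R n :> heisenberg R n.
Proof.
have EX : \sum_i p 0 i *: heisX R i = (p, 0, 0) :> heisenberg R n.
  rewrite [p in RHS]row_sum_delta.
  apply: (big_ind2 (fun (u : heisenberg R n) p' => u = (p', 0, 0))) => //.
    by move=> u1 p1 u2 p2 -> ->; congr (_, _, _); rewrite /= addr0.
  by move=> i _; congr (_, _, _); rewrite /= scaler0.
have EY : \sum_i q 0 i *: heisY R i = (0, q, 0) :> heisenberg R n.
  rewrite [q in RHS]row_sum_delta.
  apply: (big_ind2 (fun (u : heisenberg R n) p' => u = (0, p', 0))) => //.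
    by move=> u1 p1 u2 p2 -> ->; congr (_, _, _); rewrite /= addr0.
  by move=> i _; congr (_, _, _); rewrite /= scaler0.
rewrite EX EY; congr (_, _, _); rewrite /= ?scaler0 ?addr0 ?add0r //.
by rewrite /GRing.scale /= mulr1.
Qed.

Lemma heisXY (R : fieldType) (n : nat) (i j : 'I_n) :
  [Lie heisX R i, heisY R j] = if i == j then heisZ R n else 0.
Proof.
transitivity ((0, 0, (i == j)%:R) : heisenberg R n); last by case: eqP.
congr (_, _, _) => /=; rewrite (bigD1 i) //= big1 => [|k /negPf ki].
  by rewrite !mxE !eqxx /= mul1r mul0r subr0 addr0.
by rewrite !mxE ki andbF !mul0r subr0.
Qed.

Lemma heisXX (R : fieldType) (n : nat) (i j : 'I_n) :
  [Lie heisX R i, heisX R j] = 0.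
Proof.
by congr (_, _, _); apply: big1 => k _ /=; rewrite !mxE mulr0 mul0r subrr.
Qed.

Lemma heisYY (R : fieldType) (n : nat) (i j : 'I_n) :
  [Lie heisY R i, heisY R j] = 0.
Proof.
by congr (_, _, _); apply: big1 => k _ /=; rewrite !mxE mulr0 mul0r subrr.
Qed.

Lemma heisZ_central (R : fieldType) (n : nat) (u : heisenberg R n) :
  [Lie heisZ R n, u] = 0.
Proof.
by congr (_, _, _); apply: big1 => k _ /=; rewrite !mxE !mul0r subrr.
Qed.

(* Main.v *)
From HB Require Import structures.
Require Import Defs.
From mathcomp Require Import all_boot all_order all_algebra.
From mathcomp Require Import reals.

Set Implicit Arguments.
Unset Strict Implicit.
Unset Printing Implicit Defensive.

Import Order.TTheory GRing.Theory Num.Theory.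
Local Open Scope ring_scope.

(** On a Sasakian Lie algebra, w(X, Y) = g(X, Phi Y) = d alpha(X, Y) / 2 is the
    fundamental form of a Kaehler structure transverse to xi: its closedness is
    the image under alpha of the Jacobi identity, and xi spans its kernel. A
    central element lies in that kernel, and a nonzero nilpotent algebra has
    nonzero center, so xi is central (reeb_central) and the quotient by xi is a
    nilpotent Kaehler Lie algebra. The heart of the matter is that such an
    algebra is abelian. This is proved here without forming the quotient: the
    line spanned by xi is the kernel of Phi, so that equations modulo xi are
    equations between images under Phi.

    Let Z be orthogonal to xi and central modulo xi, and let D = ad(Phi Z).
    Normality makes D commute with Phi modulo xi, and closedness of w gives
      g([X, Y], Z) = w(D X, Y) + w(X, D Y)          (dot_lie_Z)
    as well as g(D Y, Z) = 0 (dot_ad_T_Z). As D is a derivation, using the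
    first identity twice in the second one gives
      w(D^2 X, Y) + 2 w(D X, D Y) + w(X, D^2 Y) = 0.
    For Y = Phi X and D^2 X = 0 modulo xi only -2 |Phi (D X)|^2 survives, so
    that D X = 0 modulo xi (Phi_ad_T_step). Since D is nilpotent, this forces
    D = 0 modulo xi, hence Z is orthogonal to the derived algebra
    (second_center_ortho_lie). But if the derived algebra were not spanned by
    xi, nilpotency would put in it some v that is central modulo xi without
    being a multiple of xi; the part of v orthogonal to xi would be orthogonal
    to itself (Phi_lie).

    Therefore [X, Y] = - 2 w(X, Y) xi (lie_sasakian), and a unitary frame
    e_i, Phi e_i of the orthogonal of xi is mapped to the standard basis of the
    Heisenberg algebra, with 2 xi in the role of the central generator. *)

(** * Nilpotent Lie algebras *)

Section LieAlgebra.
Variables (R : fieldType) (L : lieAlgType R).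
Implicit Types (x y z v : L) (V W : {vspace L}).

Lemma lieC x y : [Lie x, y] = - [Lie y, x].
Proof.
apply/eqP; rewrite -addr_eq0; apply/eqP.
have := liexx (x + y); rewrite linearDl !linearDr /= !liexx.
by rewrite addr0 add0r.
Qed.

Lemma lie_leibniz x y z :
  [Lie x, [Lie y, z]] = [Lie [Lie x, y], z] + [Lie y, [Lie x, z]].
Proof.
have /eqP := lie_jacobi x y z.
rewrite -addrA addr_eq0 => /eqP ->; rewrite opprD addrC -lieC.
by rewrite -linearNr -lieC.
Qed.

Lemma iter_lie_lower_central x y k :
  iter k (lie x) y \in lower_central L k.
Proof. by elim: k => [|k IHk]; [exact: memvf | exact/memv_lie/IHk/memvf]. Qed.

(** Ideals of a nilpotent Lie algebra contain elements that become central
    modulo W: take the last term of the lower central series that meets V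
    outside W. *)
Lemma nilpotent_ideal_center_mod V W :
    lie_nilpotent L -> (forall x v, v \in V -> [Lie x, v] \in V) ->
    ~~ (V <= W)%VS ->
  exists v, [/\ v \in V, v \notin W & forall x, [Lie x, v] \in W].
Proof.
move=> [K CK0] idealV VnW.
have exW : exists k, (V :&: lower_central L k <= W)%VS.
  by exists K; rewrite CK0 capv0 sub0v.
case: (ex_minnP exW) => -[|k] ckW kmin.
  by rewrite capvf (negPf VnW) in ckW.
have /subvPn[v /[!memv_cap]/andP[vV vC] vnW] :
    ~~ (V :&: lower_central L k <= W)%VS.
  by apply/negP => /kmin; rewrite ltnn.
exists v; split=> // x; apply: (subvP ckW).
by rewrite memv_cap idealV // memv_lie ?memvf.
Qed.

End LieAlgebra.

(** * Identities in a Sasakian Lie algebra *)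

Section Sasakian.
Variables (R : realFieldType) (L : lieAlgType R).
Variables (Phi : 'End(L)) (alpha : 'Hom(L, R^o)) (xi : L).
Variable g : {dot L for idfun}.
Hypothesis sas : is_sasakian Phi alpha xi g.
Implicit Types X Y Z : L.

Lemma dotC X Y : g X Y = g Y X.
Proof. by rewrite hermC expr0 mul1r. Qed.

Lemma dot_eq0 X : g X X = 0 -> X = 0.
Proof.
move=> gX; apply/eqP/negPn/negP => /(@neq0_dnorm_gt0 _ _ _ g).
by rewrite gX ltxx.
Qed.

Lemma alphaZ_reeb (c : R) : alpha (c *: xi) = c.
Proof. by rewrite linearZ /= (sasakian_reeb sas) /GRing.scale /= mulr1. Qed.

(** Phi^2 xi = 0 gives, for v = Phi xi, both Phi v = 0 and v = alpha(v) xi;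
    applying Phi to the latter yields alpha(v) v = 0. *)
Lemma Phi_reeb : Phi xi = 0.
Proof.
pose v := Phi xi.
have Phiv : Phi v = 0.
  by rewrite /v (sasakian_sqr sas) (sasakian_reeb sas) scale1r addNr.
have vE : v = alpha v *: xi.
  have /eqP := sasakian_sqr sas v.
  by rewrite Phiv linear0 eq_sym addrC subr_eq0 eq_sym => /eqP.
have /(congr1 alpha) : alpha v *: v = 0.
  by rewrite {2}/v -linearZ -vE.
rewrite linear0 linearZ /= => /eqP; rewrite mulf_eq0 orbb => /eqP av.
by rewrite -/v vE av scale0r.
Qed.

Lemma dot_reeb X : g xi X = alpha X.
Proof.
have := sasakian_metric sas xi X.
rewrite Phi_reeb linear0l (sasakian_reeb sas) mul1r => /eqP.
by rewrite eq_sym subr_eq0 => /eqP.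
Qed.

Lemma alpha_Phi X : alpha (Phi X) = 0.
Proof.
have /eqP := sasakian_sqr sas (Phi X).
rewrite [Phi (Phi X)](sasakian_sqr sas) linearD linearN linearZ /=.
rewrite Phi_reeb scaler0 addr0 -subr_eq0 opprD addNKr oppr_eq0.
move=> /eqP /(congr1 alpha).
by rewrite alphaZ_reeb linear0.
Qed.

Lemma dot_Phi_skew X Y : g X (Phi Y) = - g Y (Phi X).
Proof.
apply: (@mulfI _ 2); first by rewrite pnatr_eq0.
by rewrite mulrN !(sasakian_contact sas) /dform lieC linearN.
Qed.

(** The line spanned by xi is the kernel of Phi; this is how equations modulo
    xi are expressed throughout. *)
Lemma Phi_eq0 X : Phi X = 0 -> X = alpha X *: xi.
Proof.
move=> PX; have /eqP := sasakian_sqr sas X.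
by rewrite PX linear0 eq_sym addrC subr_eq0 eq_sym => /eqP.
Qed.

(** Since Phi^2 = - I + xi alpha, the component of the normality condition
    along xi cancels, leaving the integrability condition of a complex
    structure as an exact identity. *)
Lemma lie_Phi2 X Y :
  [Lie Phi X, Phi Y] = [Lie X, Y] + Phi [Lie Phi X, Y] + Phi [Lie X, Phi Y].
Proof.
have := sasakian_normal sas X Y.
rewrite /nijenhuis /dform (sasakian_sqr sas) scaleNr opprK.
set c := alpha _ *: xi; rewrite [- _ + c]addrC -!addrA => /eqP.
rewrite -subr_eq0 addrAC subrr add0r addrCA -!opprD subr_eq0 addrA.
by move/eqP.
Qed.

(** * The Reeb vector is central *)

Lemma dot_lie_Phi X Y Z :
  2 * g [Lie X, Y] (Phi Z) = - alpha [Lie [Lie X, Y], Z].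
Proof. exact: (sasakian_contact sas). Qed.

(** A central Z satisfies 2 g(Z, Phi Y) = d alpha(Z, Y) = 0 for all Y, in
    particular for Y = Phi Z. *)
Lemma center_sub_reeb Z : (forall X, [Lie X, Z] = 0) -> Phi Z = 0.
Proof.
move=> cZ; apply: dot_eq0; rewrite dot_Phi_skew.
have := sasakian_contact sas Z (Phi Z).
rewrite /dform lieC cZ oppr0 linear0 oppr0 => /eqP.
by rewrite mulf_eq0 pnatr_eq0 /= => /eqP ->; rewrite oppr0.
Qed.

(** Nilpotency provides a nonzero central element, which is a multiple of xi. *)
Lemma reeb_central X : lie_nilpotent L -> [Lie xi, X] = 0.
Proof.
move=> nilL.
have [//||Z [_]] := @nilpotent_ideal_center_mod R L fullv 0%VS nilL.
- by move=> *; rewrite memvf.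
- rewrite subv0 -subv0; apply/negP => /subvP/(_ xi (memvf _)).
  rewrite memv0 => /eqP xi0; have := sasakian_reeb sas.
  by rewrite xi0 linear0 => /esym/eqP; rewrite oner_eq0.
rewrite memv0 => Zn0 cZ.
have {}cZ Y : [Lie Y, Z] = 0 by apply/eqP; rewrite -memv0.
have ZE := Phi_eq0 (center_sub_reeb cZ).
have aZ : alpha Z != 0 by apply: contraNneq Zn0 => aZ; rewrite ZE aZ scale0r.
apply: (scalerI aZ); rewrite scaler0 -linearZl_LR /= -ZE lieC cZ.
by rewrite oppr0.
Qed.

Lemma lie_ker_Phi X Y : lie_nilpotent L -> Phi X = 0 -> [Lie X, Y] = 0.
Proof.
by move=> nilL /Phi_eq0->; rewrite linearZl_LR /= reeb_central // scaler0.
Qed.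

(** * Elements that are central modulo the Reeb vector *)

Section SecondCenter.
Hypothesis nilL : lie_nilpotent L.
Variable Z : L.
Hypothesis aZ : alpha Z = 0.
Hypothesis cZ : forall X, Phi [Lie Z, X] = 0.

Local Notation T := (Phi Z).
Local Notation D := (lie T).

Lemma PhiK_T : Phi T = - Z.
Proof. by rewrite (sasakian_sqr sas) aZ scale0r addr0. Qed.

(** This is the closedness of w on X, Y, Z, all of whose terms but one contain
    a bracket with Z. *)
Lemma dot_lie_T X Y : g [Lie X, Y] T = 0.
Proof.
apply: (@mulfI _ 2); first by rewrite pnatr_eq0.
rewrite dot_lie_Phi mulr0 lieC lie_leibniz.
rewrite [[Lie X, _]]lieC !(lie_ker_Phi _ nilL (cZ _)).
by rewrite subr0 oppr0 linear0 oppr0.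
Qed.

(** Modulo xi the bracket with Z vanishes, and integrability says that D
    commutes with Phi. *)
Lemma lie_T_Phi Y : D (Phi Y) = [Lie Z, Y] + Phi (D Y).
Proof. by rewrite lie_Phi2 cZ addr0. Qed.

(** This is the closedness of w on X, Y, T, that is, alpha applied to the
    derivation property of D, together with w(., T) = - g(., Z). *)
Lemma dot_lie_Z X Y : g [Lie X, Y] Z = g (D X) (Phi Y) + g X (Phi (D Y)).
Proof.
apply: (@mulfI _ 2); first by rewrite pnatr_eq0.
rewrite mulrDr !(sasakian_contact sas) /dform -opprD.
have -> : (alpha [Lie D X, Y] : R) + alpha [Lie X, D Y] = alpha (D [Lie X, Y]).
  by rewrite [D [Lie X, Y]]lie_leibniz linearD.
have -> : g [Lie X, Y] Z = - g [Lie X, Y] (Phi T).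
  by rewrite PhiK_T linearNr opprK.
by rewrite mulrN dot_lie_Phi [D [Lie _, _]]lieC linearN !opprK.
Qed.

(** Phi preserves g on the orthogonal of xi and carries the pair (D Y, Z) to
    a difference of brackets paired with T. *)
Lemma dot_ad_T_Z Y : g (D Y) Z = 0.
Proof.
have := sasakian_metric sas (D Y) Z; rewrite aZ mulr0 subr0 => <-.
have -> : Phi (D Y) = D (Phi Y) - [Lie Z, Y] by rewrite lie_T_Phi addrC addKr.
by rewrite linearBl /= !dot_lie_T subrr.
Qed.

(** Evaluating g(D [X, Phi X], Z) = 0 with the derivation property of D and
    the formula for g([X, Y], Z): the terms with D^2 drop out and two copies of
    - |Phi (D X)|^2 remain. *)
Lemma Phi_ad_T_step X : Phi (D (D X)) = 0 -> Phi (D X) = 0.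
Proof.
move=> PDD; apply: dot_eq0.
have PDP Y : Phi (D (Phi Y)) = Phi (Phi (D Y)).
  by rewrite lie_T_Phi linearD /= cZ add0r.
have := dot_ad_T_Z [Lie X, Phi X].
rewrite [D _]lie_leibniz linearDl /= !dot_lie_Z !PDP.
rewrite [g (D (D X)) _]dot_Phi_skew PDD linear0r oppr0 add0r.
have -> : Phi (D (D (Phi X))) = 0.
  rewrite [D (Phi X)]lie_T_Phi linearDr /= [D [Lie Z, X]]lieC.
  by rewrite (lie_ker_Phi _ nilL (cZ _)) oppr0 add0r PDP PDD linear0.
rewrite linear0r addr0 [g (D X) (Phi (Phi _))]dot_Phi_skew -opprD -mulr2n.
by move/eqP; rewrite oppr_eq0 mulrn_eq0 => /eqP.
Qed.

Lemma Phi_ad_T X : Phi (D X) = 0.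
Proof.
have [k Ck0] := nilL.
suff iterP m Y : Phi (iter m.+1 D Y) = 0 -> Phi (D Y) = 0.
  apply: (iterP k); have := iter_lie_lower_central T X k.
  by rewrite Ck0 memv0 iterS => /eqP ->; rewrite linear0r linear0.
by elim: m => // m IHm /Phi_ad_T_step.
Qed.

Lemma second_center_ortho_lie X Y : g [Lie X, Y] Z = 0.
Proof.
rewrite dot_lie_Z Phi_ad_T linear0r addr0 dot_Phi_skew.
by rewrite Phi_ad_T linear0r oppr0.
Qed.

End SecondCenter.

(** * The derived algebra is spanned by the Reeb vector *)

(** If not, an element v of the derived algebra outside the line of xi can be
    chosen central modulo xi; its part Z orthogonal to xi is then orthogonal to
    every bracket, in particular to v, so that g(Z, Z) = 0. *)
Lemma Phi_lie X Y : lie_nilpotent L -> Phi [Lie X, Y] = 0.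
Proof.
move=> nilL; apply/eqP; rewrite -memv_ker.
suff /subvP : (liev {:L} {:L} <= lker Phi)%VS.
  by apply; rewrite memv_lie ?memvf.
apply/negPn/negP => /(nilpotent_ideal_center_mod nilL)[].
  by move=> x v _; rewrite memv_lie ?memvf.
move=> v [vLL]; rewrite memv_ker => Pv vZ; set Z := v - alpha v *: xi.
have aZ : alpha Z = 0 by rewrite linearB /= alphaZ_reeb subrr.
have cZ x : Phi [Lie Z, x] = 0.
  rewrite linearBl /= linearZl_LR /= reeb_central // scaler0 subr0.
  rewrite lieC linearN /=; move: (vZ x).
  by rewrite memv_ker => /eqP ->; rewrite oppr0.
have vZ0 : g v Z = 0.
  suff /subvP/(_ v vLL) : (liev {:L} {:L} <= orthov g <[Z]>)%VS.
    by rewrite mem_orthov1 => /eqP.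
  apply: liev_sub => x y _ _; rewrite mem_orthov1.
  exact/eqP/second_center_ortho_lie.
have /dot_eq0 Z0 : g Z Z = 0.
  by rewrite {1}/Z linearBl /= vZ0 linearZl_LR /= dot_reeb aZ mulr0 subrr.
have vE : v = alpha v *: xi by apply/eqP; rewrite -subr_eq0 -/Z Z0.
by move: Pv; rewrite vE linearZ /= Phi_reeb scaler0 eqxx.
Qed.

Lemma lie_sasakian X Y :
  lie_nilpotent L -> [Lie X, Y] = - (2 * g X (Phi Y)) *: xi.
Proof.
move=> nilL; rewrite {1}(Phi_eq0 (Phi_lie X Y nilL)).
by rewrite (sasakian_contact sas) opprK.
Qed.

End Sasakian.

(** * Unitary frames and Heisenberg coordinates *)

Section UnitaryFrame.
Variables (R : rcfType) (L : lieAlgType R).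
Variables (Phi : 'End(L)) (alpha : 'Hom(L, R^o)) (xi : L).
Variable g : {dot L for idfun}.
Hypothesis sas : is_sasakian Phi alpha xi g.

(** The e_i together with the Phi e_i form an orthonormal family in the kernel
    of alpha; the metric axiom supplies the relations among the Phi e_i. *)
Definition unitary_frame k (e : 'I_k -> L) : Prop :=
  [/\ forall i, alpha (e i) = 0,
      forall i j, g (e i) (e j) = (i == j)%:R
    & forall i j, g (e i) (Phi (e j)) = 0].

(** The last coordinate is halved because [e_i, Phi e_i] = 2 xi plays the role
    of the central generator. *)
Definition frame_coord k (e : 'I_k -> L) (X : L) : heisenberg R k :=
  (\row_i g X (e i), \row_i g X (Phi (e i)), alpha X / 2).

Lemma frame_coord_is_linear k (e : 'I_k -> L) : linear (frame_coord e).
Proof.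
move=> a X Y; congr (_, _, _).
- by apply/rowP => i; rewrite !mxE linearPl.
- by apply/rowP => i; rewrite !mxE linearPl.
- by rewrite linearP /= mulrDl -scalerAl.
Qed.

HB.instance Definition _ k (e : 'I_k -> L) :=
  GRing.isLinear.Build R L (heisenberg R k) _ (frame_coord e)
    (frame_coord_is_linear e).

(** The coordinate map of a frame of size k lands in a space of dimension
    2 k + 1, so it has a nonzero kernel when the dimension of L is larger; a
    normalized kernel vector extends the frame. *)
Lemma unitary_frame_extend k (e : 'I_k -> L) :
    unitary_frame e -> (k.*2.+1 < \dim {:L})%N ->
  exists e' : 'I_k.+1 -> L, unitary_frame e'.
Proof.
move=> [ae gee gePe] ltkL; pose F := linfun (frame_coord e).
have : lker F != 0%VS.
  apply: contraTneq ltkL => ker0; rewrite -leqNgt -(limg_ker_dim F) ker0.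
  by rewrite capv0 dimv0 add0n -(dim_heisenberg R k) dimvS ?subvf.
rewrite -vpick0; set w := vpick _ => wn0.
have : w \in lker F by exact: memv_pick.
rewrite memv_ker lfunE /= => /eqP[/rowP gwe /rowP gwPe /eqP].
rewrite mulf_eq0 invr_eq0 pnatr_eq0 orbF => /eqP aw.
have {}gwe i : g w (e i) = 0 by have := gwe i; rewrite !mxE.
have {}gwPe i : g w (Phi (e i)) = 0 by have := gwPe i; rewrite !mxE.
have gw_gt0 : 0 < g w w by exact: neq0_dnorm_gt0.
pose v := (Num.sqrt (g w w))^-1 *: w.
have av : alpha v = 0 by rewrite linearZ /= aw scaler0.
have gve i : g v (e i) = 0 by rewrite linearZl_LR /= gwe mulr0.
have gvPe i : g v (Phi (e i)) = 0 by rewrite linearZl_LR /= gwPe mulr0.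
have gvv : g v v = 1.
  rewrite linearZl_LR linearZr_LR /= mulrA -expr2 exprVn sqr_sqrtr ?ltW //.
  by rewrite mulVf // gt_eqF.
have gvPv : g v (Phi v) = 0.
  have /eqP := dot_Phi_skew sas v v.
  by rewrite -addr_eq0 -mulr2n mulrn_eq0 => /eqP.
exists (fun i => if unlift ord_max i is Some j then e j else v).
split=> [i|i j|i j].
- by case: unliftP => [i' _|_].
- case: unliftP => [i' ->|->]; case: unliftP => [j' ->|->].
  + by rewrite gee (inj_eq lift_inj).
  + by rewrite (dotC g) gve eq_sym (negPf (neq_lift _ _)).
  + by rewrite gve (negPf (neq_lift _ _)).
  + by rewrite gvv eqxx.
- case: unliftP => [i' _|_]; case: unliftP => [j' _|_] //.
  by rewrite (dot_Phi_skew sas) gvPe oppr0.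
Qed.

Lemma unitary_frame_exists n :
  \dim {:L} = n.*2.+1 -> exists e : 'I_n -> L, unitary_frame e.
Proof.
move=> dimL.
suff frameP k : (k <= n)%N -> exists e : 'I_k -> L, unitary_frame e.
  exact: frameP.
elim: k => [_|k IHk ltkn]; first by exists (fun=> 0); split=> - [].
have [e ue] := IHk (ltnW ltkn).
by apply: unitary_frame_extend ue _; rewrite dimL ltnS ltn_double.
Qed.

Section FrameOfUnitary.
Variables (n : nat) (e : 'I_n -> L).
Hypothesis ue : unitary_frame e.

Definition of_frame_coord (u : heisenberg R n) : L :=
  \sum_i u.1.1 0 i *: e i + \sum_i u.1.2 0 i *: Phi (e i) + (2 * u.2) *: xi.

Lemma dot_frame_PhiPhi i j : g (Phi (e i)) (Phi (e j)) = (i == j)%:R.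
Proof.
by have [ae gee _] := ue; rewrite (sasakian_metric sas) !ae mulr0 subr0 gee.
Qed.

Lemma dot_of_frame_coord u j : g (of_frame_coord u) (e j) = u.1.1 0 j.
Proof.
have [ae gee gePe] := ue.
rewrite 2!linearDl /= !linear_sumlz linearZl_LR /= (dot_reeb sas).
rewrite ae mulr0 addr0 [X in _ + X]big1 ?addr0 => [|i _]; last first.
  by rewrite linearZl_LR /= (dotC g) gePe mulr0.
rewrite (bigD1 j) //= linearZl_LR /= gee eqxx mulr1.
rewrite big1 ?addr0 // => i /negPf ij.
by rewrite linearZl_LR /= gee ij mulr0.
Qed.

Lemma dot_of_frame_coord_Phi u j : g (of_frame_coord u) (Phi (e j)) = u.1.2 0 j.
Proof.
have [ae gee gePe] := ue.
rewrite 2!linearDl /= !linear_sumlz linearZl_LR /= (dot_reeb sas).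
rewrite (alpha_Phi sas) mulr0 addr0.
rewrite [X in X + _]big1 ?add0r => [|i _]; last first.
  by rewrite linearZl_LR /= gePe mulr0.
rewrite (bigD1 j) //= linearZl_LR /= dot_frame_PhiPhi eqxx mulr1.
rewrite big1 ?addr0 // => i /negPf ij.
by rewrite linearZl_LR /= dot_frame_PhiPhi ij mulr0.
Qed.

Lemma of_frame_coordK : cancel of_frame_coord (frame_coord e).
Proof.
move=> [[p q] z]; congr (_, _, _).
- by apply/rowP => i; rewrite mxE dot_of_frame_coord.
- by apply/rowP => i; rewrite mxE dot_of_frame_coord_Phi.
have [ae _ _] := ue.
rewrite 2!linearD !linear_sum /= (alphaZ_reeb sas) !big1 ?add0r => [|i _|i _].
- by rewrite mulrC mulKf // pnatr_eq0.
- by rewrite linearZ /= (alpha_Phi sas) scaler0.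
- by rewrite linearZ /= ae scaler0.
Qed.

Lemma dot_of_frame_coord_Phi2 u v :
  g (of_frame_coord u) (Phi (of_frame_coord v)) =
  \sum_i (u.1.2 0 i * v.1.1 0 i - u.1.1 0 i * v.1.2 0 i).
Proof.
have [ae _ _] := ue.
have -> : Phi (of_frame_coord v) =
    \sum_i (v.1.1 0 i *: Phi (e i) - v.1.2 0 i *: e i).
  rewrite 2!linearD !linear_sum linearZ /= (Phi_reeb sas) scaler0 addr0.
  rewrite -big_split; apply: eq_bigr => i _ /=.
  by rewrite !linearZ /= (sasakian_sqr sas) ae scale0r addr0 scalerN.
rewrite linear_sumr; apply: eq_bigr => i _ /=.
rewrite linearBr /= !linearZr_LR /= dot_of_frame_coord dot_of_frame_coord_Phi.
by rewrite mulrC [X in _ - X]mulrC.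
Qed.

Lemma lie_of_frame_coord u v : lie_nilpotent L ->
  [Lie of_frame_coord u, of_frame_coord v] = of_frame_coord [Lie u, v].
Proof.
move=> nilL; rewrite (lie_sasakian sas) // dot_of_frame_coord_Phi2.
rewrite -[[Lie u, v]]/(heisenberg_lie u v) /of_frame_coord /=.
rewrite [X in _ = X + _ + _]big1 => [|i _]; last by rewrite mxE scale0r.
rewrite [X in _ = _ + X + _]big1 => [|i _]; last by rewrite mxE scale0r.
rewrite !add0r; congr (_ *: _); rewrite -mulrN; congr (_ * _).
by rewrite -sumrN; apply: eq_bigr => i _; rewrite opprB.
Qed.

End FrameOfUnitary.

End UnitaryFrame.

Theorem theorem3p9 (R : realType) (n : nat) (L : lieAlgType R)
    (dimL : \dim {: L} = (2 * n).+1)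
    (nilL : lie_nilpotent L)
    (sasL : exists (Phi : 'End(L)) (alpha : 'Hom(L, R^o)) (xi : L)
              (g : {dot L for idfun}), is_sasakian Phi alpha xi g) :
  lie_isomorphic L (heisenberg R n).
Proof.
move: sasL => [Phi [alpha [xi [g sas]]]].
rewrite mul2n in dimL.
have [e ue] := unitary_frame_exists sas dimL.
pose F : 'Hom(L, heisenberg R n) := linfun (frame_coord Phi alpha g e).
pose G := of_frame_coord Phi xi e.
have GK : cancel G F.
  by move=> u; rewrite lfunE; exact: (of_frame_coordK sas ue).
have limgF : limg F = fullv.
  apply/eqP; rewrite eqEsubv subvf; apply/subvP => u _.
  by rewrite -[u]GK memv_img ?memvf.
have /lker0P injF : lker F == 0%VS.
  have := limg_ker_dim F fullv; rewrite capfv limgF dim_heisenberg dimL.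
  by move/eqP; rewrite -[X in _ == X]add0n eqn_add2r dimv_eq0.
have FK : cancel F G by move=> x; apply: injF; rewrite GK.
exists F; split; first by exists G.
by move=> x y; rewrite -{1}[x]FK -{1}[y]FK (lie_of_frame_coord sas ue) // GK.
Qed.
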